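(* Let $G$ be a connected graph, $A\in\mathcal{S}_L(G)$ and $J_A$ the associated Jacobian matrix. Then $J_A$ has full rank if and only if the eigenvalues of $A$ are distinct and $A$ has the SSPWL.
   Context: Graphs are finite and simple. For a graph $G$ on vertex set $\{1,\ldots,n\}$, $\mathcal{S}_L(G)$ denotes the set of weighted Laplacian matrices of $G$: all $n\times n$ real symmetric matrices $A=[a_{i,j}]$ with, for $i\ne j$, $a_{i,j}<0$ if $\{i,j\}\in E(G)$ and $a_{i,j}=0$ if $\{i,j\}\notin E(G)$, and with $a_{i,i}=-\sum_{k:\{k,i\}\in E(G)}a_{i,k}$ for all $i$. Let $J$ be the $n\times n$ all-ones matrix and $H=I-\frac1n J$. A matrix $A\in\mathcal{S}_L(G)$ has the strong spectral property for weighted Laplacian matrices (SSPWL) if $X=O$ is the only real symmetric $n\times n$ matrix satisfying $A\circ X=I\circ X=O$ and $H(AX-XA)H=O$, where $\circ$ is the entrywise product. For a square matrix $M$, $s_k(M)$ is the sum of all $k\times k$ principal minors of $M$. Let $e_1,\ldots,e_m$ be the edges of $G$; for $e=\{a,b\}$ let $E_e=(\mathbf e_a-\mathbf e_b)(\mathbf e_a-\mathbf e_b)^\top$, where $\mathbf e_a$ is the $a$th standard basis vector. The Jacobian matrix $J_A$ is the $(n-1)\times m$ matrix whose $(i,j)$-entry is $\frac{d}{dt}s_i(A+tE_{e_j})\big|_{t=0}$, for $i=1,\ldots,n-1$, $j=1,\ldots,m$ (i.e. $\partial s_i/\partial w_j$, where $w_j>0$ is the weight of edge $e_j$ and $A=\sum_j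 w_jE_{e_j}$). Since $G$ is connected, $m\ge n-1$, so full rank means rank $n-1$. *)

(* Defs.v *)
From HB Require Import structures.
From mathcomp Require Import all_boot all_order all_algebra.
From mathcomp Require Import reals topology normedtype derive.

Set Implicit Arguments.
Unset Strict Implicit.
Unset Printing Implicit Defensive.

Import Order.TTheory GRing.Theory Num.Theory.
Import numFieldNormedType.Exports.

Local Open Scope ring_scope.

(* A finite simple graph on n vertices is given by its adjacency relation. *)
Definition simple_graph (n : nat) (e : rel 'I_n) : Prop :=
  symmetric e /\ irreflexive e.

Definition connected_graph (n : nat) (e : rel 'I_n) : Prop :=
  forall u v : 'I_n, connect e u v.

(* The edge {a, b} is represented by the pair (a, b) with a < b, so that each
   edge occurs exactly once. *)
Definition edges (n : nat) (e : rel 'I_n) : {set 'I_n * 'I_n} :=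
  [set p : 'I_n * 'I_n | (p.1 < p.2)%N && e p.1 p.2].

Section Laplacian.
Variables (R : realType) (n : nat).
Implicit Types (e : rel 'I_n) (A X : 'M[R]_n).

Definition weighted_laplacian e A : Prop :=
  [/\ A^T = A,
      forall i j, i != j -> e i j -> A i j < 0,
      forall i j, i != j -> ~~ e i j -> A i j = 0
    & forall i, A i i = - \sum_(k | e k i) A i k].

Definition hadamard A X : 'M[R]_n := map2_mx *%R A X.

Definition centering : 'M[R]_n := 1%:M - n%:R^-1 *: const_mx 1.

Definition SSPWL A : Prop :=
  forall X, X^T = X ->
    hadamard A X = 0 -> hadamard 1%:M X = 0 ->
    centering *m (A *m X - X *m A) *m centering = 0 ->
    X = 0.

Definition principal_minor A (S : {set 'I_n}) : R :=
  \det (mxsub (@enum_val _ (mem S)) (@enum_val _ (mem S)) A).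

Definition sum_principal_minors (k : nat) A : R :=
  \sum_(S : {set 'I_n} | #|S| == k) principal_minor A S.

Definition edge_laplacian (p : 'I_n * 'I_n) : 'M[R]_n :=
  let v : 'cV[R]_n := delta_mx p.1 0 - delta_mx p.2 0 in v *m v^T.

(* Rows are indexed from 0, so row i holds the derivatives of s_(i+1). *)
Definition edge_jacobian e A : 'M[R]_(n.-1, #|edges e|) :=
  \matrix_(i, j)
    derive1
      (fun t : R =>
         sum_principal_minors i.+1 (A + t *: edge_laplacian (enum_val j)))
      0.

(* The list s of eigenvalues, repeated according to multiplicity, has no
   repetition.  A list s splitting the characteristic polynomial is unique up
   to permutation, and exists for every real symmetric A. *)
Definition distinct_eigenvalues A : Prop :=
  exists2 s : seq R, char_poly A = \prod_(a <- s) ('X - a%:P) & uniq s.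

End Laplacian.

(* Main.v *)
Require Import Defs.
From mathcomp Require Import all_boot all_order all_algebra.
From mathcomp Require Import perm.
From mathcomp Require Import boolp reals topology normedtype derive.
From mathcomp Require Import complex ring lra zify.

Set Implicit Arguments.
Unset Strict Implicit.
Unset Printing Implicit Defensive.

Import Order.TTheory GRing.Theory Num.Theory.
Import numFieldNormedType.Exports.

Local Open Scope ring_scope.

(** The sum of the principal minors of order [k] is, up to sign, a coefficient
    of the characteristic polynomial.  An edge Laplacian is [v v^T] with
    [v = e_a - e_b], so moving the weight of the edge moves the characteristic
    polynomial along a line, with slope [- v^T adj('X - A) v]
    ([char_poly_rank1_update]).  The coefficients of the adjugate are
    polynomials in [A] ([coef_adj_char_poly_mx]); the one that governs the
    minors of order [k] has degree [k - 1].  Hence, by a triangular change of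
    rows, the Jacobian has full rank if and only if there is no relation, that
    is, no nonzero polynomial [q] of degree at most [n - 2] for which
    [v^T q(A) v] vanishes for every edge ([edge_jacobian_full_rankP]).

    Two facts about a connected weighted Laplacian turn this into the theorem.
    Its kernel consists of the constant vectors, so that [A M = 0] implies
    [v^T M v = 0] for every pair of vertices.  And a real symmetric matrix has
    distinct eigenvalues exactly when its minimal polynomial has degree [n], in
    which case the matrices commuting with it are its polynomials of degree at
    most [n - 1] ([commutant_poly]).

    If the rank is full, a polynomial of degree less than [n] killing [A] has
    the form ['X r], and [r] would be a relation; so the eigenvalues are
    distinct.  If [X] is as in the definition of the SSPWL, then [H X H]
    commutes with [A], hence is a polynomial in [A]; modulo the polynomial [r]
    with [char_poly A = 'X r] its degree is at most [n - 2], and [v^T H X H v =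
    v^T X v] vanishes on edges, which leads to [X = 0]
    ([full_rank_SSPWL]).  Conversely a relation [q] produces a matrix [X],
    equal to [q(A)] up to terms that centering removes, that contradicts the
    SSPWL unless [A^2 q(A) = 0], which is impossible when the eigenvalues are
    distinct ([distinct_SSPWL_full_rank]). *)

(** * Principal minors and the characteristic polynomial *)

Lemma det_mxsub_inj (S : comPzRingType) (m n : nat) (f : 'I_m -> 'I_n)
    (M : 'M[S]_n) :
  injective f -> m = n -> \det (mxsub f f M) = \det M.
Proof.
move=> f_inj eq_mn; case: n / eq_mn f f_inj M => f f_inj M.
pose P : 'M[S]_m := perm_mx (perm f_inj).
have -> : mxsub f f M = P *m M *m P^T.
  rewrite tr_perm_mx -row_permE -col_permE.
  by apply/matrixP=> i j; rewrite !mxE !permE.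
by rewrite !det_mulmx det_tr det_perm mulrAC -expr2 sqrr_sign mul1r.
Qed.

(** Listing the elements of [J] first and the other indices next makes the
    matrix block upper triangular, with the principal submatrix on [J] and a
    scalar matrix on the diagonal. *)
Lemma det_outside_scalar (S : comPzRingType) (n : nat) (x : S) (M : 'M[S]_n)
    (J : {set 'I_n}) :
  \det (\matrix_(i, j) if i \in J then M i j else (x%:M : 'M[S]_n) i j) =
  x ^+ (n - #|J|) *
  \det (mxsub (@enum_val _ (mem J)) (@enum_val _ (mem J)) M).
Proof.
set N := \matrix_(i, j) _.
pose f (k : 'I_(#|J| + #|~: J|)) : 'I_n :=
  match split k with inl i => enum_val i | inr i => enum_val i end.
have fl i : f (lshift _ i) = enum_val i by rewrite /f (unsplitK (inl _)).
have fr i : f (rshift _ i) = enum_val i by rewrite /f (unsplitK (inr _)).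
have inJ (i : 'I_#|J|) : enum_val i \in J := enum_valP i.
have outJ (i : 'I_#|~: J|) : (enum_val i \in J) = false.
  by apply/negbTE; have := enum_valP i; rewrite inE.
have f_inj : injective f.
  move=> k l; case: (split_ordP k) => i ->; case: (split_ordP l) => j ->;
    rewrite ?fl ?fr => E.
  - by rewrite (enum_val_inj E).
  - by have := inJ i; rewrite E outJ.
  - by have := inJ j; rewrite -E outJ.
  - by rewrite (enum_val_inj E).
have eqn : (#|J| + #|~: J|)%N = n by rewrite cardsC card_ord.
rewrite -(det_mxsub_inj N f_inj eqn) -[mxsub f f N]submxK.
have -> : dlsubmx (mxsub f f N) = 0.
  apply/matrixP=> i j; rewrite !mxE fl fr outJ.
  by case: eqP => // E; have := inJ j; rewrite -E outJ.
have -> : drsubmx (mxsub f f N) = x%:M.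
  apply/matrixP=> i j; rewrite !mxE !fr outJ.
  by rewrite (inj_eq enum_val_inj).
have -> : (n - #|J|)%N = #|~: J| by rewrite -[X in (X - _)%N]eqn addKn.
rewrite det_ublock det_scalar mulrC; congr (_ * \det _).
by apply/matrixP=> i j; rewrite !mxE !fl inJ.
Qed.

(** The Leibniz formula has a product of sums [x%:M i (s i) + M i (s i)] for
    each permutation [s]; distributing it over the set [J] of rows where the
    entry of [M] is chosen gives the determinants of [det_outside_scalar]. *)
Lemma det_scalarD_minors (S : comPzRingType) (n : nat) (x : S) (M : 'M[S]_n) :
  \det (x%:M + M) =
  \sum_(J : {set 'I_n}) x ^+ (n - #|J|) *
    \det (mxsub (@enum_val _ (mem J)) (@enum_val _ (mem J)) M).
Proof.
under [RHS]eq_bigr do rewrite -det_outside_scalar.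
rewrite exchange_big /=; apply: eq_bigr => s _; rewrite -mulr_sumr.
congr (_ * _); under eq_bigr do rewrite mxE addrC.
by rewrite bigA_distr; apply: eq_bigr => J _; apply: eq_bigr => i _;
  rewrite mxE.
Qed.

Lemma sum_principal_minorsE (R : realType) (n k : nat) (A : 'M[R]_n) :
  (k <= n)%N ->
  sum_principal_minors k A = (-1) ^+ k * (char_poly A)`_(n - k).
Proof.
move=> le_kn; rewrite /char_poly /char_poly_mx det_scalarD_minors coef_sum.
rewrite mulr_sumr (bigID (fun J : {set 'I_n} => #|J| == k)) /=.
rewrite [X in _ + X]big1 ?addr0 => [|J neqk].
  apply: eq_bigr => J /eqP cardJ.
  rewrite /principal_minor -map_mxN -map_mxsub det_map_mx coefMC coefXn.
  have -> : mxsub (@enum_val _ (mem J)) (@enum_val _ (mem J)) (- A) =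
      -1 *: mxsub (@enum_val _ (mem J)) (@enum_val _ (mem J)) A.
    by apply/matrixP=> i j; rewrite !mxE mulN1r.
  have -> : (n - k == n - #|J|)%N by rewrite cardJ.
  rewrite detZ mul1r mulrA.
  have -> : (-1) ^+ k * (-1) ^+ #|J| = 1 :> R.
    by rewrite cardJ -exprMn mulrNN mulr1 expr1n.
  by rewrite mul1r.
rewrite -map_mxN -map_mxsub det_map_mx coefMC coefXn.
have /negPf-> : (n - k != n - #|J|)%N.
  apply: contra neqk => /eqP E; have := max_card (mem J);
    rewrite card_ord => leJn.
  by rewrite -(subKn leJn) -E subKn.
by rewrite mul0r mulr0.
Qed.

(** * Rank one perturbations *)

(** The bordered matrix [[M, u], [-v, 1]] has determinant [det (M + u v)], by
    clearing its last row.  Multiplying it on the right by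
    [[1, - adj M u], [0, det M]] clears its upper right block instead, which
    gives the formula times [det M].  Over an integral domain this factor can
    be cancelled, so [M] need not be invertible: the lemma applies to
    [char_poly_mx A], whose determinant is monic. *)
Lemma det_rank1_update (S : idomainType) (n : nat) (M : 'M[S]_n)
    (u : 'cV[S]_n) (v : 'rV[S]_n) :
  \det M != 0 -> \det (M + u *m v) = \det M + (v *m \adj M *m u) 0 0.
Proof.
move=> detM_neq0.
pose B : 'M[S]_(n + 1) := block_mx M u (- v) 1%:M.
have detB : \det B = \det (M + u *m v).
  have : \det (B *m block_mx 1%:M 0 v 1%:M) = \det (M + u *m v).
    by rewrite mulmx_block !mulmx1 !mul1mx !mulmx0 addNr !add0r det_ublock
      det1 mulr1.
  by rewrite det_mulmx det_lblock !det1 !mulr1.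
apply: (mulIf detM_neq0); rewrite -detB.
have /(congr1 determinant) : B *m block_mx 1%:M (- \adj M *m u) 0 (\det M)%:M
    = block_mx M 0 (- v) (v *m \adj M *m u + (\det M)%:M).
  rewrite mulmx_block !mulmx1 !mul1mx !mulmx0 !addr0 mul_mx_scalar.
  rewrite mulmxA mulmxN mul_mx_adj !mulNmx mul_scalar_mx addNr.
  by rewrite mulmxN opprK mulmxA.
rewrite det_mulmx det_ublock det_lblock det1 mul1r det_scalar1 => ->.
by rewrite det_mx11 !mxE eqxx mulr1n mulrC addrC.
Qed.

(** With [B k] the [k]-th coefficient of the adjugate and [chi] the
    characteristic polynomial, the identity [('X - A) adj ('X - A) = chi] reads
    [B k = A B (k+1) + chi_(k+1)].  This is the Horner recursion for the
    polynomials obtained by shifting [chi], and both sides vanish for large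
    [k], from which the induction descends. *)
Lemma coef_adj_char_poly_mx (F : fieldType) (n' : nat) (A : 'M[F]_n'.+1) k :
  map_mx (coefp k) (\adj (char_poly_mx A)) =
  horner_mx A (drop_poly k.+1 (char_poly A)).
Proof.
set D := \adj _; set chi := char_poly A.
have recD j : map_mx (coefp j) D =
    A * map_mx (coefp j.+1) D + (chi`_j.+1)%:M.
  have := mul_mx_adj (char_poly_mx A).
  rewrite -/D -/(char_poly A) -/chi {1}/char_poly_mx mulmxBl mul_scalar_mx.
  move=> /(congr1 (map_mx (coefp j.+1))) /matrixP E.
  apply/matrixP=> a b; have := E a b.
  rewrite !mxE /= coefB coefXM coefMn /= => <-; rewrite coef_sum.
  under [X in _ - X]eq_bigr do rewrite mxE coefCM.
  under [X in X + _]eq_bigr do rewrite mxE /=.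
  by rewrite addrC subrK.
have recH j : horner_mx A (drop_poly j.+1 chi) =
    A * horner_mx A (drop_poly j.+2 chi) + (chi`_j.+1)%:M.
  have -> : drop_poly j.+1 chi = 'X * drop_poly j.+2 chi + (chi`_j.+1)%:P.
    apply/polyP=> i; rewrite coefD coefXM coefC !coef_drop_poly.
    by case: i => [|i]; rewrite ?add0r //= addr0 addSnnS.
  by rewrite rmorphD rmorphM /= horner_mx_X horner_mx_C.
pose N := maxn (size chi) (\max_a \max_b size (D a b)).
have large j : (N <= j)%N -> map_mx (coefp j) D = 0 /\ drop_poly j.+1 chi = 0.
  rewrite geq_max => /andP[le1 le2]; split; last exact/drop_poly_eq0/leqW.
  apply/matrixP=> a b; rewrite mxE [RHS]mxE /= nth_default //.
  by apply: leq_trans (leq_trans (leq_bigmax a) le2); apply: (leq_bigmax b).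
have: (N <= k + N)%N by rewrite leq_addl.
move: {2}N => m; elim: m k => [|m IHm] k.
  by rewrite addn0 => /large[-> ->]; rewrite rmorph0.
by rewrite -addSnnS => /IHm E; rewrite recD recH E.
Qed.

Definition pair_vec (S : pzRingType) (n : nat) (a b : 'I_n) : 'cV[S]_n :=
  delta_mx a 0 - delta_mx b 0.

(** The pairing of [M] with the Laplacian of the edge [{a, b}], that is, the
    trace of their product.  Being rank one, that Laplacian pairs with [M]
    through the quadratic form of [M] at [pair_vec a b].  Below, [M] is called
    orthogonal to the pair when this value is zero. *)
Definition pair_form (V : zmodType) (n : nat) (a b : 'I_n) (M : 'M[V]_n) : V :=
  M a a - M a b - M b a + M b b.

Lemma pair_formE (S : pzRingType) (n : nat) (a b : 'I_n) (M : 'M[S]_n) :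
  (pair_vec S a b)^T *m M *m pair_vec S a b = (pair_form a b M)%:M.
Proof.
rewrite /pair_vec linearB /= !trmx_delta mulmxBl mulmxBr !mulmxBl.
have E (i j : 'I_n) : delta_mx (0 : 'I_1) i *m M *m delta_mx j (0 : 'I_1) =
  (M i j)%:M.
  by rewrite -rowE -colE; apply/matrixP=> k l; rewrite !mxE !ord1.
rewrite !E -!raddfB /pair_form /= opprB addrA addrAC.
by congr (_ + _)%:M; exact: addrAC.
Qed.

(** Changing the weight of one edge is a rank one update, so the characteristic
    polynomial is an affine function of the weight; its slope is minus
    the pairing of the edge with the adjugate of ['X - A]. *)
Lemma char_poly_rank1_update (F : fieldType) (n' k : nat) (A : 'M[F]_n'.+1)
    (a b : 'I_n'.+1) (t : F) :
  (char_poly (A + t *: (pair_vec F a b *m (pair_vec F a b)^T)))`_k =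
  (char_poly A)`_k -
  t * pair_form a b (horner_mx A (drop_poly k.+1 (char_poly A))).
Proof.
set v := pair_vec F a b.
have -> : char_poly (A + t *: (v *m v^T)) =
    \det (char_poly_mx A + map_mx polyC (- t *: v) *m map_mx polyC v^T).
  rewrite /char_poly /char_poly_mx; congr (\det _).
  by rewrite -map_mxM map_mxD opprD addrA scaleNr mulNmx map_mxN scalemxAl.
rewrite det_rank1_update; last exact/monic_neq0/char_poly_monic.
rewrite coefD; congr (_ + _).
rewrite -coef_adj_char_poly_mx; set D := \adj _.
have -> : map_mx polyC (- t *: v) = (- t)%:P *: pair_vec {poly F} a b.
  by apply/matrixP=> i j; rewrite !mxE rmorphM rmorphB /= !rmorph_nat.
have -> : map_mx polyC v^T = (pair_vec {poly F} a b)^T.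
  by apply/matrixP=> i j; rewrite !mxE rmorphB /= !rmorph_nat.
rewrite -scalemxAr pair_formE !mxE eqxx mulr1n coefCM mulNr; congr (- (_ * _)).
by rewrite /pair_form !mxE /= !(coefD, coefN).
Qed.

Lemma derive1_affine (R : realType) (c d : R) :
  derive1 (fun t : R => c + t * d) 0 = d.
Proof.
by rewrite derive1E derive_val scaler0 !add0r /GRing.scale /= mulr1.
Qed.

Lemma pair_formB (S : comNzRingType) (n : nat) (a b : 'I_n) (M N : 'M[S]_n) :
  pair_form a b (M - N) = pair_form a b M - pair_form a b N.
Proof. by rewrite /pair_form !mxE; ring. Qed.

Lemma pair_form_sumZ (S : pzRingType) (n d : nat) (a b : 'I_n) (c : 'I_d -> S)
    (M : 'I_d -> 'M[S]_n) :
  pair_form a b (\sum_i c i *: M i) = \sum_i c i * pair_form a b (M i).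
Proof.
rewrite /pair_form !summxE -!sumrB -big_split /=.
by apply: eq_bigr => i _; rewrite !mxE mulrDr !mulrBr.
Qed.

Lemma pair_formZ (S : comNzRingType) (n : nat) (a b : 'I_n) (c : S)
    (M : 'M[S]_n) :
  pair_form a b (c *: M) = c * pair_form a b M.
Proof. by rewrite /pair_form !mxE; ring. Qed.

(** * The rank of the Jacobian *)

Lemma edge_jacobianE (R : realType) (n' : nat) (e : rel 'I_n'.+1)
    (A : 'M[R]_n'.+1) i j :
  edge_jacobian e A i j =
  (-1) ^+ i * pair_form (enum_val j).1 (enum_val j).2
    (horner_mx A (drop_poly (n' - i).+1 (char_poly A))).
Proof.
rewrite mxE; set f := pair_form _ _ _; set chi := char_poly A.
rewrite -[RHS](derive1_affine ((-1) ^+ i.+1 * chi`_(n' - i))).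
congr (derive1 _ 0); apply/funext => t.
rewrite sum_principal_minorsE; last by rewrite ltnS ltnW.
rewrite subSS char_poly_rank1_update -/f -/chi.
by rewrite exprS; ring.
Qed.

(** Row [i] of the Jacobian pairs the edges with a polynomial in [A] of degree
    [i] and leading coefficient [1] or [-1].  So the Jacobian is an invertible
    triangular matrix [T] times the matrix [K] of pairings of the edges with
    the powers of [A] below [n'], and the linear relations between the rows of
    [K] are the polynomials of size at most [n'] in the statement. *)
Lemma edge_jacobian_full_rankP (R : realType) (n' : nat) (e : rel 'I_n'.+1)
    (A : 'M[R]_n'.+1) :
  \rank (edge_jacobian e A) = n' <->
  forall q : {poly R}, (size q <= n')%N ->
    (forall p, p \in edges e -> pair_form p.1 p.2 (horner_mx A q) = 0) -> q = 0.
Proof.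
pose K : 'M[R]_(n', #|edges e|) :=
  \matrix_(i, j) pair_form (enum_val j).1 (enum_val j).2 (A ^+ i).
pose T : 'M[R]_n' := \matrix_i
  poly_rV ((-1) ^+ i *: drop_poly (n' - i).+1 (char_poly A)).
have KE (c : 'rV_n') j : (c *m K) 0 j =
    pair_form (enum_val j).1 (enum_val j).2 (horner_mx A (rVpoly c)).
  rewrite [c in RHS]row_sum_delta !linear_sum /=.
  under [in RHS]eq_bigr do rewrite !linearZ /= rVpoly_delta rmorphXn /=
    horner_mx_X.
  by rewrite pair_form_sumZ mxE; apply: eq_bigr => i _; rewrite mxE.
have TE i : rVpoly (row i T) = (-1) ^+ i *: drop_poly (n' - i).+1 (char_poly A).
  rewrite rowK poly_rV_K // (leq_trans (size_scale_leq _ _)) //.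
  by rewrite size_drop_poly size_char_poly subSS subSn
    ?leq_subr // subKn // ltnW.
have JE : edge_jacobian e A = T *m K.
  apply/matrixP=> i j; rewrite edge_jacobianE.
  have -> : (T *m K) i j = (row i T *m K) 0 j by rewrite -row_mul [RHS]mxE.
  rewrite KE TE linearZ /=.
  by rewrite pair_formZ.
have T_unit : T \in unitmx.
  have trigT : is_trig_mx T.
    apply/is_trig_mxP => i j lt_ij; rewrite !mxE coefZ coef_drop_poly.
    rewrite nth_default ?mulr0 // size_char_poly.
    by have := ltn_ord i; lia.
  rewrite unitmxE det_trig // unitfE prodf_seq_neq0; apply/allP => i _ /=.
  rewrite !mxE coefZ coef_drop_poly addnS subnKC 1?ltnW //.
  have := char_poly_monic A; rewrite monicE lead_coefE size_char_poly => /eqP->.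
  by rewrite mulr1 signr_eq0.
have -> : \rank (edge_jacobian e A) = \rank K.
  by rewrite JE (eqmxMfull K) // row_full_unit.
have formK (c : 'rV_n') : c *m K = 0 <-> forall p, p \in edges e ->
    pair_form p.1 p.2 (horner_mx A (rVpoly c)) = 0.
  split=> [cK0 p pe | H].
    rewrite -[p](enum_rankK_in pe) // -KE cK0 mxE //.
  by apply/rowP=> j; rewrite KE mxE H // enum_valP.
split=> [rankK q le_q /= H | H].
  have /row_freeP[L KL] : row_free K by apply/eqP.
  have qK : poly_rV q *m K = 0 by apply/formK; rewrite poly_rV_K.
  rewrite -(poly_rV_K le_q) -[poly_rV q]mulmx1 -KL mulmxA qK mul0mx.
  by rewrite linear0.
apply/eqP/inj_row_free => c /formK cK.
by rewrite -[c]rVpolyK (H (rVpoly c) (size_poly _ _) cK) linear0.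
Qed.

(** * Symmetric matrices with distinct eigenvalues *)

(** A unitary matrix conjugates a Hermitian matrix to a real diagonal one, and
    conjugate matrices have the same minimal polynomial. *)
Lemma hermitian_mxminpoly (C : numClosedFieldType) (n' : nat)
    (A : 'M[C]_n'.+1) :
  A \is hermsymmx ->
  exists2 d : 'rV[C]_n'.+1, d \is a mxOver Num.real &
    mxminpoly A = mxminpoly (diag_mx d).
Proof.
move=> hermA; exists (spectral_diag A);
  first exact: hermitian_spectral_diag_real.
have /orthomx_spectralP AE := hermitian_normalmx hermA.
have Pu := spectral_unit A.
have AE' : A = conjmx (invmx (spectralmx A)) (diag_mx (spectral_diag A)).
  by rewrite (conjVmx _ Pu); exact: AE.
transitivity (mxminpoly (conjmx (invmx (spectralmx A))
  (diag_mx (spectral_diag A)))).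
  exact: congr1 AE'.
by apply: mxminpoly_uconj; rewrite unitmx_inv.
Qed.

(** The minimal polynomial does not change when the scalars are extended to the
    complex field, where the spectral theorem makes it a product of distinct
    real linear factors. *)
Lemma symmetric_mxminpoly_split (R : rcfType) (n' : nat) (A : 'M[R]_n'.+1) :
  A^T = A ->
  exists2 s : seq R, uniq s & mxminpoly A = \prod_(a <- s) ('X - a%:P).
Proof.
move=> symA; pose toC : {rmorphism R -> R[i]} := real_complex R.
pose AC := map_mx toC A.
have realAC : AC \is a mxOver Num.real.
  by apply/mxOverP=> i j; rewrite mxE complex_real.
have hermAC : AC \is hermsymmx.
  apply: realsym_hermsym => //; apply/is_hermitianmxP.
  by rewrite expr0 scale1r map_mx_id // /AC map_trmx symA.
have [dC dC_real minAC] := hermitian_mxminpoly hermAC.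
have [d dE] : exists d : 'rV[R]_n'.+1, dC = map_mx toC d.
  exists (map_mx (@complex.Re R) dC); apply/rowP=> i;
    rewrite [RHS]mxE [X in toC X]mxE.
  exact: (esym (RRe_real (mxOverP dC_real 0 i))).
exists (undup [seq d 0 i | i <- enum 'I_n'.+1]); first exact: undup_uniq.
rewrite -mxminpoly_diag; apply: (map_poly_inj toC).
transitivity (mxminpoly AC); first by rewrite (mxminpoly_map toC A).
rewrite minAC dE -(map_diag_mx toC).
exact: (mxminpoly_map toC (diag_mx d)).
Qed.

(** Each of the [n'+1] eigenvalues is a root of the minimal polynomial. *)
Lemma distinct_eigenvalues_mxminpoly (R : realType) (n' : nat)
    (A : 'M[R]_n'.+1) :
  distinct_eigenvalues A -> mxminpoly A = char_poly A.
Proof.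
case=> s chiE s_uniq; apply/eqP.
rewrite -eqp_monic ?mxminpoly_monic ?char_poly_monic //.
rewrite /eqp mxminpoly_dvd_char chiE uniq_roots_dvdp ?uniq_rootsE //.
by apply/allP=> a; rewrite root_mxminpoly chiE root_prod_XsubC.
Qed.

Lemma symmetric_distinct_eigenvalues (R : realType) (n' : nat)
    (A : 'M[R]_n'.+1) :
  A^T = A -> mxminpoly A = char_poly A -> distinct_eigenvalues A.
Proof.
move=> symA minA; have [s s_uniq sE] := symmetric_mxminpoly_split symA.
by exists s; rewrite // -minA.
Qed.

Lemma horner_mx_eq0_small (F : fieldType) (n' : nat) (A : 'M[F]_n'.+1)
    (q : {poly F}) :
  mxminpoly A = char_poly A -> (size q <= n'.+1)%N -> horner_mx A q = 0 ->
    q = 0.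
Proof.
move=> minA le_q /mxminpoly_min dvdq; apply: contraTeq le_q => q_neq0.
by rewrite -ltnNge -(size_char_poly A) -minA dvdp_leq.
Qed.

Lemma mxminpoly_eq_char_poly (F : fieldType) (n' : nat) (A : 'M[F]_n'.+1) :
  (forall q : {poly F}, (size q <= n'.+1)%N -> horner_mx A q = 0 -> q = 0) ->
  mxminpoly A = char_poly A.
Proof.
move=> H; apply/eqP.
rewrite -eqp_monic ?mxminpoly_monic ?char_poly_monic // -dvdp_size_eqp
  ?mxminpoly_dvd_char //.
rewrite eqn_leq dvdp_leq ?mxminpoly_dvd_char ?monic_neq0 ?char_poly_monic //=.
rewrite size_char_poly ltnNge; apply/negP=> le_min.
have := monic_neq0 (mxminpoly_monic A).
by rewrite (H _ le_min (mx_root_minpoly A)) eqxx.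
Qed.

(** Distinct diagonal entries force [Z] to be diagonal.  Interpolating its
    entries at those of [d], through the inverse of a Vandermonde matrix, gives
    the polynomial. *)
Lemma diag_commutant_poly (F : fieldType) (n' : nat) (d : 'rV[F]_n'.+1)
    (Z : 'M[F]_n'.+1) :
  injective (d 0) -> Z *m diag_mx d = diag_mx d *m Z ->
  exists2 q : {poly F}, (size q <= n'.+1)%N & Z = horner_mx (diag_mx d) q.
Proof.
move=> d_inj comZ.
have Z_diag i j : i != j -> Z i j = 0.
  move=> neq_ij; have /matrixP/(_ i j) := comZ;
    rewrite mul_mx_diag mul_diag_mx !mxE.
  move/eqP; rewrite -subr_eq0 [d 0 i * _]mulrC -mulrBr mulf_eq0 subr_eq0.
  by rewrite (inj_eq d_inj) [j == i]eq_sym (negPf neq_ij) orbF => /eqP.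
pose V := Vandermonde n'.+1 d.
have V_unit : V \in unitmx.
  rewrite unitmxE det_Vandermonde unitfE prodf_seq_neq0; apply/allP => i _ /=.
  rewrite prodf_seq_neq0; apply/allP => j _; apply/implyP => lt_ij.
  by rewrite subr_eq0 (inj_eq d_inj) neq_ltn lt_ij orbT.
pose c : 'rV_n'.+1 := (\row_i Z i i) *m invmx V.
exists (rVpoly c); first exact: size_poly.
have cV : c *m V = \row_i Z i i by rewrite mulmxKV.
rewrite horner_mx_diag; apply/matrixP=> i j; rewrite !mxE.
have [-> | neq_ij] := eqVneq i j; last by rewrite Z_diag.
have /rowP/(_ j) := cV; rewrite mxE [RHS]mxE mulr1n => <-.
rewrite (horner_coef_wide _ (size_poly _ _)).
by apply: eq_bigr => k _; rewrite coef_rVpoly_ord [V k j]mxE.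
Qed.

(** Distinct eigenvalues make [A] diagonalizable with distinct diagonal entries,
    and conjugation commutes with evaluating polynomials. *)
Lemma commutant_poly (R : realType) (n' : nat) (A Y : 'M[R]_n'.+1) :
  distinct_eigenvalues A -> A *m Y = Y *m A ->
  exists2 q : {poly R}, (size q <= n'.+1)%N & Y = horner_mx A q.
Proof.
move=> distA comAY; have minA := distinct_eigenvalues_mxminpoly distA.
case: distA => s chiE s_uniq.
have : diagonalizable A.
  by apply/diagonalizableP; exists s => //; rewrite -chiE mxminpoly_dvd_char.
case=> P P_unit /diagonalizable_forPex[d] simA.
have d_inj : injective (d 0).
  have := simmx_minpoly P_unit simA; rewrite minA mxminpoly_diag.
  move/(congr1 (fun p : {poly R} => size p)).
  rewrite size_char_poly size_prod_XsubC => -[size_d].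
  apply/injectiveP; rewrite /injectiveb /dinjectiveb -[uniq _]negbK.
  by rewrite -ltn_size_undup -size_d size_map size_enum_ord ltnn.
have DE : diag_mx d = P *m A *m invmx P by apply/(simmxRL P_unit).
have conjM (M N : 'M[R]_n'.+1) :
    P *m M *m invmx P *m (P *m N *m invmx P) = P *m (M *m N) *m invmx P.
  by rewrite !mulmxA mulmxKV.
have [|q le_q qE] := @diag_commutant_poly _ _ d (P *m Y *m invmx P) d_inj.
  by rewrite DE !conjM comAY.
exists q => //; move: qE; rewrite DE horner_mx_uconj // => qE.
apply: (row_free_inj (A := invmx P)); first by rewrite row_free_unit unitmx_inv.
by apply: (can_inj (mulKmx P_unit)); rewrite !mulmxA.
Qed.

(** * Weighted Laplacians *)

Lemma laplacian_row_sum (R : realType) (n : nat) (e : rel 'I_n)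
    (A : 'M[R]_n) i :
  simple_graph e -> weighted_laplacian e A -> \sum_j A i j = 0.
Proof.
move=> [e_sym e_irr] [symA _ A0 Adiag]; rewrite (bigD1 i) //= Adiag addrC.
apply/eqP; rewrite subr_eq0; apply/eqP.
rewrite (bigID (fun j => e j i)) /= [X in _ + X]big1 ?addr0.
  by apply: eq_bigl => j; case: eqVneq => [->|]; rewrite ?e_irr.
by move=> j /andP[neq_ji nadj]; rewrite A0 1?eq_sym // e_sym.
Qed.

Lemma laplacian_mul_const (R : realType) (n : nat) (e : rel 'I_n)
    (A : 'M[R]_n) m (c : R) :
  simple_graph e -> weighted_laplacian e A ->
  A *m (const_mx c : 'M_(n, m)) = 0.
Proof.
move=> simple_e lapA; apply/matrixP=> i j; rewrite !mxE.
under eq_bigr do rewrite mxE.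
by rewrite -mulr_suml (laplacian_row_sum i simple_e lapA) mul0r.
Qed.

Lemma const_mul_laplacian (R : realType) (n : nat) (e : rel 'I_n)
    (A : 'M[R]_n) m (c : R) :
  simple_graph e -> weighted_laplacian e A ->
  (const_mx c : 'M_(m, n)) *m A = 0.
Proof.
move=> simple_e lapA; apply: trmx_inj; rewrite trmx_mul trmx_const trmx0.
by have [-> _ _ _] := lapA; apply: laplacian_mul_const lapA.
Qed.

(** Expanding the square, the terms in [x i] squared and [x j] squared vanish
    because rows and columns of [A] sum to zero, and the mixed term because
    [A x = 0]. *)
Lemma laplacian_energy_eq0 (R : realType) (n : nat) (e : rel 'I_n) (A : 'M[R]_n)
    (x : 'cV[R]_n) :
  simple_graph e -> weighted_laplacian e A -> A *m x = 0 ->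
  \sum_i \sum_j A i j * (x i 0 - x j 0) ^+ 2 = 0.
Proof.
move=> simple_e lapA Ax0; have [symA _ _ _] := lapA.
have E i : \sum_j A i j * (x i 0 - x j 0) ^+ 2 = \sum_j A i j * x j 0 ^+ 2.
  transitivity (\sum_j (x i 0 ^+ 2 * A i j - x i 0 *+ 2 * (A i j * x j 0) +
      A i j * x j 0 ^+ 2)).
    by apply: eq_bigr => j _; ring.
  rewrite big_split sumrB -!mulr_sumr
    (laplacian_row_sum i simple_e lapA) /= mulr0 sub0r.
  have /colP/(_ i) := Ax0; rewrite !mxE => ->.
  by rewrite mulr0 oppr0 add0r.
under eq_bigr do rewrite E.
rewrite exchange_big /= big1 // => j _; rewrite -mulr_suml.
have -> : \sum_i A i j = \sum_i A j i by apply: eq_bigr => i _;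
  rewrite -{1}symA mxE.
by rewrite (laplacian_row_sum j simple_e lapA) mul0r.
Qed.

(** All terms of the energy are nonpositive with sum zero, so each vanishes and
    [x] takes equal values at adjacent vertices. *)
Lemma laplacian_kernel_const (R : realType) (n : nat) (e : rel 'I_n)
    (A : 'M[R]_n) (x : 'cV[R]_n) :
  simple_graph e -> connected_graph e -> weighted_laplacian e A ->
  A *m x = 0 -> forall i j, x i 0 = x j 0.
Proof.
move=> simple_e conn_e lapA Ax0 i j.
have term_le0 k l : A k l * (x k 0 - x l 0) ^+ 2 <= 0.
  have [_ Aneg A0 _] := lapA; have [->|neq_kl] := eqVneq k l.
    by rewrite subrr expr0n mulr0.
  rewrite mulr_le0_ge0 ?sqr_ge0 //; case: (boolP (e k l)) => [/Aneg/ltW -> //|].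
  by move/A0 ->.
have term_eq0 k l : A k l * (x k 0 - x l 0) ^+ 2 = 0.
  have := laplacian_energy_eq0 simple_e lapA Ax0.
  move/(congr1 -%R); rewrite oppr0 -sumrN => /eqP.
  rewrite psumr_eq0 => [/allP/(_ k (mem_index_enum _))|m _] /=; last first.
    by rewrite oppr_ge0 sumr_le0.
  rewrite -sumrN psumr_eq0 => [/allP/(_ l (mem_index_enum _))|m _] /=;
    last first.
    by rewrite oppr_ge0.
  by rewrite oppr_eq0 => /eqP.
have adj_eq k l : e k l -> x k 0 = x l 0.
  move=> ekl; have [_ Aneg _ _] := lapA; have [_ e_irr] := simple_e.
  have neq_kl : k != l by apply: contraTneq ekl => ->; rewrite e_irr.
  have /eqP := term_eq0 k l; rewrite mulf_eq0 (lt_eqF (Aneg k l neq_kl ekl)) /=.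
  by rewrite expf_eq0 subr_eq0 => /eqP.
have cl : fingraph.closed e [pred k | x k 0 == x j 0].
  by move=> k l ekl; rewrite !inE (adj_eq k l ekl).
by have := fingraph.closed_connect cl (conn_e i j); rewrite !inE eqxx => /eqP.
Qed.

Lemma laplacian_mul_eq0 (R : realType) (n : nat) (e : rel 'I_n)
    (A M : 'M[R]_n) :
  simple_graph e -> connected_graph e -> weighted_laplacian e A ->
  A *m M = 0 -> forall i j k, M i k = M j k.
Proof.
move=> simple_e conn_e lapA AM0 i j k.
have Acol : A *m col k M = 0 by rewrite colE mulmxA AM0 mul0mx.
by have := laplacian_kernel_const simple_e conn_e lapA Acol i j; rewrite !mxE.
Qed.

(** The columns of [M] are constant, and the pairing with an edge is a
    combination of differences of entries in one column. *)
Lemma pair_form_of_laplacian_mul_eq0 (R : realType) (n : nat) (e : rel 'I_n)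
    (A M : 'M[R]_n) a b :
  simple_graph e -> connected_graph e -> weighted_laplacian e A ->
  A *m M = 0 -> pair_form a b M = 0.
Proof.
move=> simple_e conn_e lapA AM0.
have cstM := laplacian_mul_eq0 simple_e conn_e lapA AM0.
by rewrite /pair_form (cstM b a a) (cstM b a b); ring.
Qed.

(** The columns of [A M] are constant because [A] kills them, and they sum to
    zero because the columns of [A] do. *)
Lemma laplacian_sqr_mul_eq0 (R : realType) (n : nat) (e : rel 'I_n)
    (A M : 'M[R]_n) :
  simple_graph e -> connected_graph e -> weighted_laplacian e A ->
  A *m (A *m M) = 0 -> A *m M = 0.
Proof.
move=> simple_e conn_e lapA AAM0; apply/matrixP=> i j; rewrite [RHS]mxE.
have cst := laplacian_mul_eq0 simple_e conn_e lapA AAM0.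
have : (const_mx 1 *m (A *m M)) i j = 0.
  by rewrite mulmxA (const_mul_laplacian _ _ simple_e lapA) mul0mx mxE.
rewrite mxE; under eq_bigr do rewrite mxE mul1r (cst _ i).
rewrite sumr_const card_ord => /eqP; rewrite mulrn_eq0 => /orP[/eqP n0|/eqP //].
by have := ltn_ord i; rewrite [X in (_ < X)%N]n0.
Qed.

Lemma horner_mx_sym (S : comNzRingType) (n' : nat) (A : 'M[S]_n'.+1)
    (q : {poly S}) :
  A^T = A -> (horner_mx A q)^T = horner_mx A q.
Proof.
move=> symA; elim/poly_ind: q => [|q c IHq]; first by rewrite rmorph0 trmx0.
rewrite rmorphD rmorphM /= horner_mx_X horner_mx_C linearD /= tr_scalar_mx.
by rewrite trmx_mul IHq symA; congr (_ + _); apply/esym/comm_horner_mx.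
Qed.

Lemma laplacian_horner_const (R : realType) (n' : nat) (e : rel 'I_n'.+1)
    (A : 'M[R]_n'.+1) (q : {poly R}) :
  simple_graph e -> weighted_laplacian e A ->
  horner_mx A q *m (const_mx 1 : 'cV_n'.+1) = const_mx q`_0.
Proof.
move=> simple_e lapA; elim/poly_ind: q => [|q c _].
  by rewrite rmorph0 mul0mx coef0.
rewrite rmorphD rmorphM /= horner_mx_X horner_mx_C mulmxDl -mulmxA.
rewrite (laplacian_mul_const _ _ simple_e lapA) mulmx0 add0r coefD coefMX
  coefC /=.
by apply/colP=> i; rewrite mul_scalar_mx !mxE mulr1 add0r.
Qed.

(** Applied to the all-ones vector, [p] evaluated at [A] gives the constant term
    of [p].  So this term vanishes and a factor ['X] splits off. *)
Lemma laplacian_annihilator_drop (R : realType) (n' : nat) (e : rel 'I_n'.+1)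
    (A : 'M[R]_n'.+1) (p : {poly R}) :
  simple_graph e -> weighted_laplacian e A -> horner_mx A p = 0 ->
  p = drop_poly 1 p * 'X /\ A *m horner_mx A (drop_poly 1 p) = 0.
Proof.
move=> simple_e lapA pA0.
have p0 : p`_0 = 0.
  have /colP/(_ ord0) := laplacian_horner_const p simple_e lapA.
  by rewrite pA0 mul0mx !mxE.
have pE : p = drop_poly 1 p * 'X.
  apply/polyP=> i; rewrite coefMX coef_drop_poly.
  by case: i => [|i]; rewrite ?addn1.
split=> //; rewrite -pA0 {2}pE rmorphM /= horner_mx_X.
exact/esym/comm_horner_mx.
Qed.

(** * Centering *)

Lemma centering_sym (R : realType) n : (centering R n)^T = centering R n.
Proof. by rewrite /centering linearB linearZ /= trmx1 trmx_const. Qed.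

Lemma centering_mul_pair_vec (R : realType) n (a b : 'I_n) :
  centering R n *m pair_vec R a b = pair_vec R a b.
Proof.
rewrite /centering mulmxBl mul1mx -scalemxAl.
suff -> : (const_mx 1 : 'M_n) *m pair_vec R a b = 0 by rewrite scaler0 subr0.
rewrite /pair_vec mulmxBr -!colE; apply/matrixP=> i j.
by rewrite !mxE subrr.
Qed.

(** The centering matrix fixes [pair_vec a b]. *)
Lemma pair_form_centering (R : realType) n (a b : 'I_n) (M : 'M[R]_n) :
  pair_form a b (centering R n *m M *m centering R n) = pair_form a b M.
Proof.
have : (pair_form a b (centering R n *m M *m centering R n))%:M =
    (pair_form a b M)%:M :> 'M_1.
  rewrite -!pair_formE !mulmxA -[_ *m centering R n *m pair_vec _ _ _]mulmxA.
  by rewrite centering_mul_pair_vec -{1}centering_sym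
    -trmx_mul centering_mul_pair_vec.
by move/matrixP/(_ 0 0); rewrite !mxE.
Qed.

Lemma mul_laplacian_centering (R : realType) (n : nat) (e : rel 'I_n)
    (A : 'M[R]_n) :
  simple_graph e -> weighted_laplacian e A -> A *m centering R n = A.
Proof.
move=> simple_e lapA; rewrite /centering mulmxBr mulmx1 -scalemxAr.
by rewrite (laplacian_mul_const _ _ simple_e lapA) scaler0 subr0.
Qed.

Lemma mul_centering_laplacian (R : realType) (n : nat) (e : rel 'I_n)
    (A : 'M[R]_n) :
  simple_graph e -> weighted_laplacian e A -> centering R n *m A = A.
Proof.
move=> simple_e lapA; rewrite /centering mulmxBl mul1mx -scalemxAl.
by rewrite (const_mul_laplacian _ _ simple_e lapA) scaler0 subr0.
Qed.

(** A weighted Laplacian absorbs the centering matrix on both sides. *)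
Lemma centering_commutator (R : realType) (n : nat) (e : rel 'I_n)
    (A X : 'M[R]_n) :
  simple_graph e -> weighted_laplacian e A ->
  let Y := centering R n *m X *m centering R n in
  centering R n *m (A *m X - X *m A) *m centering R n = A *m Y - Y *m A.
Proof.
move=> simple_e lapA Y; rewrite /Y.
move: (mul_laplacian_centering simple_e lapA)
  (mul_centering_laplacian simple_e lapA).
move: (centering R n) => H AH HA.
by rewrite mulmxBr mulmxBl !mulmxA HA AH -!mulmxA HA AH.
Qed.

(** * The equivalence *)

(** It suffices that no nonzero polynomial of size at most [n'+1] kills [A].
    Such a polynomial is ['X r] with [A r(A) = 0]; then [r(A)] is
    orthogonal to all edges, and [r] is small enough for full rank to give
    [r = 0]. *)
Lemma full_rank_distinct_eigenvalues (R : realType) (n' : nat)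
    (e : rel 'I_n'.+1) (A : 'M[R]_n'.+1) :
  simple_graph e -> connected_graph e -> weighted_laplacian e A ->
  \rank (edge_jacobian e A) = n' -> distinct_eigenvalues A.
Proof.
move=> simple_e conn_e lapA /edge_jacobian_full_rankP indep.
have [symA _ _ _] := lapA; apply: symmetric_distinct_eigenvalues => //.
apply: mxminpoly_eq_char_poly => q le_q qA0.
have [qE Ar0] := laplacian_annihilator_drop simple_e lapA qA0.
rewrite qE (indep (drop_poly 1 q)) ?mul0r //.
  by rewrite size_drop_poly leq_subLR.
by move=> p _; apply: pair_form_of_laplacian_mul_eq0 lapA Ar0.
Qed.

Lemma symmetric_eq_pair_form0 (R : realType) (n : nat) (X : 'M[R]_n) :
  X^T = X -> (forall i, X i i = 0) -> (forall a b, pair_form a b X = 0) ->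
    X = 0.
Proof.
move=> symX X0 formX; apply/matrixP=> a b; rewrite mxE.
have := formX a b; rewrite /pair_form !X0 -[in X b a]symX mxE; lra.
Qed.

(** Off the diagonal, the nonzero entries of [A] are exactly those on edges. *)
Lemma laplacian_pattern (R : realType) (n : nat) (e : rel 'I_n)
    (A X : 'M[R]_n) :
  simple_graph e -> weighted_laplacian e A -> X^T = X ->
  (hadamard A X = 0 /\ hadamard 1%:M X = 0) <->
  (forall i, X i i = 0) /\ (forall p, p \in edges e -> X p.1 p.2 = 0).
Proof.
move=> [e_sym e_irr] [_ Aneg A0 _] symX; split.
  case=> AX IX; split=> [i | p].
    by have /matrixP/(_ i i) := IX; rewrite !mxE eqxx mul1r.
  rewrite inE => /andP[lt_p ep].
  have neq_p : p.1 != p.2 by rewrite -val_eqE /= neq_ltn lt_p.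
  have /matrixP/(_ p.1 p.2)/eqP := AX; rewrite !mxE mulf_eq0.
  by rewrite (lt_eqF (Aneg _ _ neq_p ep)) => /eqP.
case=> Xd Xe; split; apply/matrixP=> i j; rewrite !mxE.
  have [->|neq_ij] := eqVneq i j; first by rewrite Xd mulr0.
  have [eij|/A0->] := boolP (e i j); rewrite ?mul0r //.
  suff -> : X i j = 0 by rewrite mulr0.
  have [lt_ij|lt_ji|/val_inj/eqP] := ltngtP i j; last by rewrite (negPf neq_ij).
    by apply: (Xe (i, j)); rewrite inE /= lt_ij.
  by rewrite -symX mxE; apply: (Xe (j, i)); rewrite inE /= lt_ji e_sym.
by have [->|] := eqVneq i j; rewrite ?Xd ?mulr0 ?mul0r.
Qed.

(** The centered matrix [Y] of [X] commutes with [A], hence is a polynomial in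
    [A] of size at most [n'+1].  With [chi = 'X r], the matrix [r(A)] is
    orthogonal to every pair of vertices, and [r] is monic of size [n'+1], so
    a multiple of it can be subtracted to bring the size down to [n'].  The
    result is still orthogonal to the edges, where [Y] and [X] have the same
    pairings, so full rank makes it zero.  Then [Y], and with it [X], is
    orthogonal to every pair of vertices, which forces [X = 0]. *)
Lemma full_rank_SSPWL (R : realType) (n' : nat) (e : rel 'I_n'.+1)
    (A : 'M[R]_n'.+1) :
  simple_graph e -> connected_graph e -> weighted_laplacian e A ->
  \rank (edge_jacobian e A) = n' -> SSPWL A.
Proof.
move=> simple_e conn_e lapA rankJ X symX AX0 IX0 comm0.
have distA := full_rank_distinct_eigenvalues simple_e conn_e lapA rankJ.
have /edge_jacobian_full_rankP indep := rankJ.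
have [Xd Xe] : (forall i, X i i = 0) /\
    (forall p, p \in edges e -> X p.1 p.2 = 0).
  exact/(laplacian_pattern simple_e lapA symX).
apply: symmetric_eq_pair_form0 => // a b; rewrite -pair_form_centering.
move: comm0; rewrite (centering_commutator X simple_e lapA) /=.
set Y := centering R _ *m X *m _ => /eqP; rewrite subr_eq0 => /eqP comY.
have [q le_q qE] := commutant_poly distA comY.
have [_ Ar0] := laplacian_annihilator_drop simple_e lapA (Cayley_Hamilton A).
set r := drop_poly 1 (char_poly A) in Ar0.
have rA_form c d : pair_form c d (horner_mx A r) = 0.
  exact: pair_form_of_laplacian_mul_eq0 lapA Ar0.
have rn : r`_n' = 1.
  have := char_poly_monic A; rewrite monicE lead_coefE size_char_poly /=.
  by rewrite coef_drop_poly addn1 => /eqP.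
have size_r : size r = n'.+1 by rewrite size_drop_poly size_char_poly subn1.
have YE : Y = horner_mx A (q - q`_n' *: r) + q`_n' *: horner_mx A r.
  by rewrite rmorphB /= linearZ /= subrK.
suff q'0 : q - q`_n' *: r = 0.
  by rewrite YE q'0 rmorph0 add0r pair_formZ rA_form mulr0.
apply: indep.
  apply/leq_sizeP => j; rewrite leq_eqVlt coefB coefZ => /orP[/eqP <-|lt_j].
    by rewrite rn mulr1 subrr.
  rewrite (nth_default _ (leq_trans le_q lt_j)) [r`_j]nth_default ?size_r //.
  by rewrite mulr0 subr0.
move=> p pe; rewrite rmorphB /= linearZ /= pair_formB pair_formZ rA_form mulr0
  subr0.
have Xe' : X p.2 p.1 = 0 by rewrite -symX mxE Xe.
by rewrite -qE pair_form_centering /pair_form !Xd Xe // Xe' !subr0 addr0.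
Qed.

Lemma mul_annihilated_terms (S : pzRingType) (n m : nat) (H M : 'M[S]_n)
    (u w : 'M[S]_(n, m)) (v t : 'M[S]_(m, n)) :
  v *m H = 0 -> H *m w = 0 -> H *m (M - u *m v - w *m t) *m H = H *m M *m H.
Proof.
move=> vH Hw; rewrite !mulmxBr !mulmxBl.
rewrite -[H *m (u *m v) *m H]mulmxA -[u *m v *m H]mulmxA.
by rewrite vH !mulmx0 [H *m (w *m t)]mulmxA Hw !mul0mx !subr0.
Qed.

(** A relation between the rows of the Jacobian is a polynomial [q] for which
    [M = q(A)] is orthogonal to the edges.  Subtracting half of the diagonal
    entries of [M] from its rows and columns gives a matrix [X] that vanishes
    on the diagonal and on the edges, and has the same centering as [M].
    Since [M] commutes with [A], the SSPWL yields [X = 0], hence [H M H = 0]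
    and [A M A = 0].  So [A^2 q(A) = 0], hence [A q(A) = 0], and ['X q] is too
    short to annihilate a matrix with distinct eigenvalues. *)
Lemma distinct_SSPWL_full_rank (R : realType) (n' : nat) (e : rel 'I_n'.+1)
    (A : 'M[R]_n'.+1) :
  simple_graph e -> connected_graph e -> weighted_laplacian e A ->
  distinct_eigenvalues A -> SSPWL A -> \rank (edge_jacobian e A) = n'.
Proof.
move=> simple_e conn_e lapA distA sspA; apply/edge_jacobian_full_rankP.
move=> q le_q qe0; have [symA _ _ _] := lapA.
set M := horner_mx A q in qe0 *.
have symM : M^T = M by apply: horner_mx_sym.
pose u : 'cV[R]_n'.+1 := \col_i (M i i / 2).
pose X := M - u *m const_mx 1 - const_mx 1 *m u^T.
have XE i j : X i j = M i j - M i i / 2 - M j j / 2.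
  by rewrite !mxE !big_ord1 !mxE mulr1 mul1r.
have symX : X^T = X.
  by apply/matrixP=> i j; rewrite mxE !XE -[in M j i]symM mxE; ring.
set H := centering R n'.+1.
have HC m (c : R) : H *m (const_mx c : 'M_(n'.+1, m)) = 0.
  apply/matrixP=> i j; rewrite mulmxBl mul1mx -scalemxAl !mxE.
  under eq_bigr do rewrite !mxE mul1r.
  by rewrite sumr_const card_ord -[c *+ _]mulr_natl mulKf ?subrr ?pnatr_eq0.
have HXH : H *m X *m H = H *m M *m H.
  have CH : (const_mx 1 : 'rV_n'.+1) *m H = 0.
    by apply: trmx_inj; rewrite trmx_mul centering_sym trmx_const HC trmx0.
  exact: mul_annihilated_terms.
have comM : A *m M = M *m A by apply/esym/comm_horner_mx.
have AH : A *m H = A := mul_laplacian_centering simple_e lapA.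
have HA : H *m A = A := mul_centering_laplacian simple_e lapA.
have X0 : X = 0.
  have [|AX IX] := (laplacian_pattern simple_e lapA symX).2.
    split=> [i | p pe]; first by rewrite XE; lra.
    have := qe0 p pe; rewrite /pair_form XE -[in M p.2 p.1]symM mxE; lra.
  apply: sspA => //; rewrite (centering_commutator X simple_e lapA) HXH.
  rewrite !mulmxA AH -!mulmxA HA.
  by rewrite -comM !mulmxA HA comM -mulmxA AH subrr.
have AMA : A *m M *m A = 0.
  have <- : A *m (H *m M *m H) *m A = A *m M *m A.
    by rewrite !mulmxA AH -!mulmxA HA.
  by rewrite -HXH X0 mulmx0 mul0mx mulmx0 mul0mx.
have AM0 : A *m M = 0.
  by apply: laplacian_sqr_mul_eq0 lapA _ => //; rewrite comM mulmxA.
have /eqP : q * 'X = 0.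
  apply: horner_mx_eq0_small (distinct_eigenvalues_mxminpoly distA) _ _.
    by rewrite (leq_trans (size_polyMleq _ _)) // size_polyX addn2.
  by rewrite rmorphM /= horner_mx_X -[RHS]AM0 comM.
by rewrite mulf_eq0 polyX_eq0 orbF => /eqP.
Qed.

Theorem theorem3p8 (R : realType) (n : nat) (e : rel 'I_n) (A : 'M[R]_n) :
  simple_graph e -> connected_graph e -> weighted_laplacian e A ->
  (\rank (edge_jacobian e A) = n.-1 <-> distinct_eigenvalues A /\ SSPWL A).
Proof.
case: n e A => [|n'] e A simple_e conn_e lapA; split.
- move=> _; split; last by move=> X *; apply/matrixP => -[].
  by exists [::]; rewrite // big_nil /char_poly det_mx00.
- by move=> _; apply/eqP; rewrite -leqn0 rank_leq_row.
- by move=> rankJ; split; [apply: full_rank_distinct_eigenvalues rankJ |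
    apply: full_rank_SSPWL rankJ].
- by case; apply: distinct_SSPWL_full_rank.
Qed.
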